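(* Let $n\ge 4$ and let $Z_1,\dots,Z_n$ be real random variables such that $Z_1^2+\cdots+Z_n^2=1$ and such that, for all positive integers $m_1,\dots,m_r$ with $m_1+\cdots+m_r\le 4$, the moment $$\beta_{2m_1,\dots,2m_r}:=\mathbb E\left[Z_{i_1}^{2m_1}Z_{i_2}^{2m_2}\cdots Z_{i_r}^{2m_r}\right]$$ is the same for every choice of pairwise distinct indices $i_1,\dots,i_r\in\{1,\dots,n\}$. Then for any real numbers $a_1,\dots,a_n$ with $a_1+\cdots+a_n=1$, $$\mathbb E\Big[\Big(\sum_{k=1}^n a_k(nZ_k^2-1)\Big)^4\Big]=K_{4,4}\,n^4\beta_{4,4}+K_{2,2}\,n^2\beta_{2,2}+K_{2,2,2}\,n^3\beta_{2,2,2}+K_{2,2,2,2}\,n^4\beta_{2,2,2,2}+K,$$ where, with $S_j=a_1^j+\cdots+a_n^j$ for $j\ge1$, $$K_{4,4}=3S_2^2-4S_3+nS_4,\qquad K=6nS_2-4n^2S_3+n^3S_4-3,$$ $$K_{2,2}=-12nS_2+8n^2S_3-2n^3S_4+6,$$ $$K_{2,2,2}=8nS_2-2nS_2^2+\frac{8n(1-2n)}{3}S_3+\frac{2n^2(2n-1)}{3}S_4-4,$$ $$K_{2,2,2,2}=-2nS_2+(2n-3)S_2^2+\frac{4(n^2-2n+3)}{3}S_3-\frac{n(n^2-2n+3)}{3}S_4+1.$$ In particular, $$K+K_{4,4}+K_{2,2}+K_{2,2,2}+K_{2,2,2,2}=0.$$ *)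

(* Defs.v *)
From HB Require Import structures.
From mathcomp Require Import all_boot all_order all_algebra.
From mathcomp Require Import all_classical all_reals all_analysis.

Set Implicit Arguments.
Unset Strict Implicit.
Unset Printing Implicit Defensive.

Import Order.TTheory GRing.Theory Num.Theory.
Import numFieldNormedType.Exports.

Local Open Scope ring_scope.

(* The mixed moment E[Z_{i_1}^{e_1} ... Z_{i_r}^{e_r}] for e = [:: e_1; ..; e_r]
   and i = [:: i_1; ..; i_r]; it is only meant for size e = size i, as zip
   truncates the longer list. *)
Definition mixed_moment (d : measure_display) (T : measurableType d)
    (R : realType) (P : probability T R) (n : nat) (Z : 'I_n -> {RV P >-> R})
    (e : seq nat) (i : seq 'I_n) : \bar R :=
  ('E_P[fun w => (\prod_(p <- zip i e) Z p.1 w ^+ p.2)%R])%E.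

(* The existence of beta expresses that the moments of order at most 8 with even
   exponents do not depend on the choice of the distinct indices; beta is
   indexed by the exponents, so that e.g. the moment beta_{4,4} of the
   mathematical notation is beta [:: 4; 4]. *)
Definition common_even_moments (d : measure_display) (T : measurableType d)
    (R : realType) (P : probability T R) (n : nat) (Z : 'I_n -> {RV P >-> R})
    (beta : seq nat -> \bar R) : Prop :=
  forall (m : seq nat) (i : seq 'I_n),
    all (fun mj => 0 < mj)%N m -> (sumn m <= 4)%N ->
    size i = size m -> uniq i ->
    mixed_moment Z [seq (2 * mj)%N | mj <- m] i = beta [seq (2 * mj)%N | mj <- m].

Definition power_sum (R : realType) (n : nat) (a : 'I_n -> R) (j : nat) : R :=
  \sum_(k < n) a k ^+ j.

Section Coefficients.
Variables (R : realType) (n : nat) (a : 'I_n -> R).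

Local Notation N := (n%:R : R).
Local Notation S j := (power_sum a j).

Definition K_44 : R := 3 * S 2 ^+ 2 - 4 * S 3 + N * S 4.

Definition K_const : R :=
  6 * N * S 2 - 4 * N ^+ 2 * S 3 + N ^+ 3 * S 4 - 3.

Definition K_22 : R :=
  - 12 * N * S 2 + 8 * N ^+ 2 * S 3 - 2 * N ^+ 3 * S 4 + 6.

Definition K_222 : R :=
  8 * N * S 2 - 2 * N * S 2 ^+ 2
  + 8 * N * (1 - 2 * N) / 3 * S 3
  + 2 * N ^+ 2 * (2 * N - 1) / 3 * S 4 - 4.

Definition K_2222 : R :=
  - 2 * N * S 2 + (2 * N - 3) * S 2 ^+ 2
  + 4 * (N ^+ 2 - 2 * N + 3) / 3 * S 3
  - N * (N ^+ 2 - 2 * N + 3) / 3 * S 4 + 1.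

End Coefficients.

(* Main.v *)
Require Import Defs.
From HB Require Import structures.
From mathcomp Require Import all_boot all_order all_algebra.
From mathcomp Require Import all_classical all_reals all_analysis.
From mathcomp Require Import measurable_realfun ring.

Set Implicit Arguments.
Unset Strict Implicit.
Unset Printing Implicit Defensive.

Import Order.TTheory GRing.Theory Num.Theory.
Import numFieldNormedType.Exports.

Local Open Scope ring_scope.

(** On the sphere, \sum_k a_k (n Z_k^2 - 1) = \sum_k c_k Z_k^2 with
    c_k = n a_k - 1, and \sum_k c_k = 0. The fourth moment is therefore the
    quartic form of M i j k l = E[Z_i^2 Z_j^2 Z_k^2 Z_l^2] at the centred vector
    c (expectation_centered_form).

    By hypothesis M only depends on which of its four indices coincide, so it is
    a linear combination of products of Kronecker deltas, one product for each
    set partition of the four positions (delta_expansion). The quartic form of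
    such a product is the product over the blocks of the power sums of c, and a
    block of size one contributes \sum_k c_k = 0. Only the three pairings and
    the partition in one block survive, which leaves a combination of
    (\sum_k c_k^2)^2 and \sum_k c_k^4 (centered_quad); both are polynomials in
    n and the power sums of a.

    The coefficients involve E[Z_i^8], E[Z_i^6 Z_j^2] and E[Z_i^4 Z_j^2 Z_k^2].
    Summing M over one index removes a factor Z_l^2, because \sum_l Z_l^2 = 1;
    this gives linear relations (the marginal lemmas) that express these three
    moments by the four that occur in the formula (quad_moment).

    The Z_k^2 are at most 1 only almost everywhere, so they are replaced by
    min(Z_k^2, 1): this changes no expectation and makes every integrand bounded
    everywhere, hence integrable. *)

(** * Quartic forms with exchangeable coefficients *)

(** The five values are indexed by the integer partitions of 4; the symmetry
    clauses reduce every arrangement of a pattern to the one displayed. *)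
Record exchangeable4 (R : realType) (n : nat)
    (M : 'I_n -> 'I_n -> 'I_n -> 'I_n -> R) (m4 m31 m22 m211 m1111 : R) :
    Prop := {
  swap12 : forall i j k l, M i j k l = M j i k l;
  swap23 : forall i j k l, M i j k l = M i k j l;
  swap34 : forall i j k l, M i j k l = M i j l k;
  pattern4 : forall i, M i i i i = m4;
  pattern31 : forall i j, i != j -> M i i i j = m31;
  pattern22 : forall i j, i != j -> M i i j j = m22;
  pattern211 : forall i j k, uniq [:: i; j; k] -> M i i j k = m211;
  pattern1111 : forall i j k l, uniq [:: i; j; k; l] -> M i j k l = m1111 }.

Section Exchangeable.
Variables (R : realType) (n : nat).
Variable M : 'I_n -> 'I_n -> 'I_n -> 'I_n -> R.
Variables m4 m31 m22 m211 m1111 : R.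
Hypothesis hM : exchangeable4 M m4 m31 m22 m211 m1111.

Local Notation D i j := ((i == j)%:R : R).

(** The Moebius transforms of the five values on the lattice of set partitions
   of four points, indexed by the nontrivial block sizes. *)
Let c2 : R := m211 - m1111.
Let c22 : R := m22 - 2 * m211 + m1111.
Let c3 : R := m31 - 3 * m211 + 2 * m1111.
Let c4 : R := m4 - 4 * m31 - 3 * m22 + 12 * m211 - 6 * m1111.

(** The fifteen delta products, one for each set partition of the positions,
    span the functions of the coincidence pattern. The first four lines gather
    the partitions in which the position of l, k, j, i respectively is a
    singleton (each partition in the first line that applies), so that each line
    is a function of the other three indices. *)
Lemma delta_expansion i j k l :
  M i j k l =
    (m1111 + c2 * (D i j + D i k + D j k) + c3 * (D i j * D j k))
  + (c2 * (D i l + D j l) + c3 * (D i j * D j l))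
  + (c2 * D k l + c3 * (D i k * D k l))
  + c3 * (D j k * D k l)
  + c22 * (D i j * D k l + D i k * D j l + D i l * D j k)
  + c4 * (D i j * D j k * D k l).
Proof.
rewrite /c2 /c22 /c3 /c4.
have [<-|ij] := eqVneq i j.
  have [<-|ik] := eqVneq i k.
    have [<-|il] := eqVneq i l.
      by rewrite (pattern4 hM) /=; ring.
    by rewrite (pattern31 hM)//; rewrite /=; ring.
  have [<-|il] := eqVneq i l.
    by rewrite (swap34 hM) (pattern31 hM) // eq_sym (negbTE ik) /=; ring.
  have [<-|kl] := eqVneq k l.
    by rewrite (pattern22 hM) //=; ring.
  by rewrite (pattern211 hM) /= ?inE ?negb_or ?ik ?il ?kl //; rewrite /=; ring.
have ji : j != i by rewrite eq_sym.
have [<-|ik] := eqVneq i k.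
  rewrite (swap23 hM) (negbTE ji).
  have [<-|il] := eqVneq i l.
    by rewrite (swap34 hM) (pattern31 hM) // (negbTE ji); rewrite /=; ring.
  have [<-|jl] := eqVneq j l.
    by rewrite (pattern22 hM) //=; ring.
  by rewrite (pattern211 hM) /= ?inE ?negb_or ?ij ?il ?jl //; rewrite /=; ring.
have [<-|jk] := eqVneq j k.
  rewrite (swap12 hM) (swap23 hM).
  have [<-|il] := eqVneq i l.
    by rewrite (negbTE ji) (pattern22 hM)//; rewrite /=; ring.
  have [<-|jl] := eqVneq j l.
    by rewrite (swap34 hM) (pattern31 hM) //=; ring.
  by rewrite (pattern211 hM) /= ?inE ?negb_or ?ji ?il ?jl //; rewrite /=; ring.
have [<-|il] := eqVneq i l.
  rewrite (swap34 hM) (swap23 hM) (pattern211 hM).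
    by rewrite (negbTE ji) eq_sym (negbTE ik); rewrite /=; ring.
  by rewrite /= !inE negb_or ij ik jk.
have [<-|jl] := eqVneq j l.
  rewrite (swap34 hM) (swap12 hM) (swap23 hM) (pattern211 hM).
    by rewrite eq_sym (negbTE jk); rewrite /=; ring.
  by rewrite /= !inE negb_or ji ik jk.
have [<-|kl] := eqVneq k l.
  rewrite (swap23 hM) (swap12 hM) (swap34 hM) (swap23 hM) (pattern211 hM).
    by rewrite /=; ring.
  by rewrite /= !inE negb_or !(eq_sym k) ij ik jk.
rewrite (pattern1111 hM); first by rewrite /=; ring.
by rewrite /= !inE !negb_or ij ik jk il jl kl.
Qed.

Lemma sum_deltal (F : 'I_n -> R) i : \sum_l D i l * F l = F i.
Proof.
rewrite (bigD1 i) //= eqxx mul1r big1 ?addr0 // => l li.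
by rewrite eq_sym (negbTE li) mul0r.
Qed.

Definition quad (c : 'I_n -> R) (F : 'I_n -> 'I_n -> 'I_n -> 'I_n -> R) : R :=
  \sum_i \sum_j \sum_k \sum_l c i * c j * c k * c l * F i j k l.

Lemma quadD c F G : quad c (fun i j k l => F i j k l + G i j k l) =
  quad c F + quad c G.
Proof.
rewrite /quad; do 4 (rewrite -big_split; apply: eq_bigr => ? _).
by rewrite mulrDr.
Qed.

Lemma quadZ c x F : quad c (fun i j k l => x * F i j k l) = x * quad c F.
Proof.
rewrite /quad; do 4 (rewrite mulr_sumr; apply: eq_bigr => ? _).
by rewrite mulrCA.
Qed.

Lemma eq_quad c F G : (forall i j k l, F i j k l = G i j k l) ->
  quad c F = quad c G.
Proof.
by move=> FG; rewrite /quad; do 4 (apply: eq_bigr => ? _); rewrite FG.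
Qed.

Lemma quad_swap12 c F : quad c F = quad c (fun i j k l => F j i k l).
Proof.
rewrite /quad exchange_big; do 4 (apply: eq_bigr => ? _).
by rewrite [c _ * c _]mulrC.
Qed.

Lemma quad_swap23 c F : quad c F = quad c (fun i j k l => F i k j l).
Proof.
rewrite /quad; apply: eq_bigr => ? _; rewrite exchange_big.
do 3 (apply: eq_bigr => ? _).
by ring.
Qed.

Lemma quad_swap34 c F : quad c F = quad c (fun i j k l => F i j l k).
Proof.
rewrite /quad; do 2 (apply: eq_bigr => ? _); rewrite exchange_big.
do 2 (apply: eq_bigr => ? _).
by ring.
Qed.

Section CenteredForm.
Variable c : 'I_n -> R.
Hypothesis c0 : \sum_k c k = 0.

(** Summing first over the missing index produces the factor \sum_k c_k = 0. *)
Lemma quad_indep4 (F : 'I_n -> 'I_n -> 'I_n -> R) :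
  quad c (fun i j k l => F i j k) = 0.
Proof.
rewrite /quad; do 3 (apply: big1 => ? _).
by rewrite -mulr_suml -mulr_sumr c0 mulr0 mul0r.
Qed.

Lemma quad_indep3 (F : 'I_n -> 'I_n -> 'I_n -> R) :
  quad c (fun i j k l => F i j l) = 0.
Proof. by rewrite quad_swap34 quad_indep4. Qed.

Lemma quad_indep2 (F : 'I_n -> 'I_n -> 'I_n -> R) :
  quad c (fun i j k l => F i k l) = 0.
Proof. by rewrite quad_swap23 quad_indep3. Qed.

Lemma quad_indep1 (F : 'I_n -> 'I_n -> 'I_n -> R) :
  quad c (fun i j k l => F j k l) = 0.
Proof. by rewrite quad_swap12 quad_indep2. Qed.

Lemma quad_pair : quad c (fun i j k l => D i j * D k l) = power_sum c 2 ^+ 2.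
Proof.
rewrite /quad expr2 /power_sum mulr_suml; apply: eq_bigr => i _.
rewrite -[c i ^+ 2](sum_deltal (fun j => c i * c j)) mulr_suml.
apply: eq_bigr => j _.
rewrite mulr_sumr; apply: eq_bigr => k _.
rewrite -[c k ^+ 2](sum_deltal (fun l => c k * c l)) mulr_sumr.
by apply: eq_bigr => l _; ring.
Qed.

Lemma quad_diag : quad c (fun i j k l => D i j * D j k * D k l) = power_sum c 4.
Proof.
rewrite /quad /power_sum; apply: eq_bigr => i _.
rewrite -[RHS](sum_deltal (fun j => c i * c j ^+ 3)); apply: eq_bigr => j _.
have -> : c i * c j ^+ 3 = \sum_k D j k * (c i * c j * c k ^+ 2).
  by rewrite sum_deltal; ring.
rewrite mulr_sumr.
apply: eq_bigr => k _.
rewrite -[c k ^+ 2](sum_deltal (fun l => c k * c l)) !mulr_sumr.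
by apply: eq_bigr => l _; ring.
Qed.

(** In the expansion of M every partition with a singleton block is killed by
    the centring of c; the pairings and the full block remain. *)
Lemma centered_quad :
  quad c M = 3 * c22 * power_sum c 2 ^+ 2 + c4 * power_sum c 4.
Proof.
rewrite (eq_quad c delta_expansion) !quadD !quadZ !quadD.
have p2 : quad c (fun i j k l => D i k * D j l) = power_sum c 2 ^+ 2.
  by rewrite quad_swap23 quad_pair.
have p3 : quad c (fun i j k l => D i l * D j k) = power_sum c 2 ^+ 2.
  by rewrite quad_swap34 -p2.
rewrite quad_pair p2 p3 quad_diag.
rewrite !quad_indep4 !quad_indep3 !quad_indep2 !quad_indep1.
by ring.
Qed.

End CenteredForm.

Lemma sum_off_seq (F : 'I_n -> R) s x : uniq s ->
  (forall l, l \notin s -> F l = x) ->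
  \sum_l F l = \sum_(l <- s) F l + (n%:R - (size s)%:R) * x.
Proof.
move=> us Fx;
have : \sum_l (F l - x) = \sum_(l <- s) (F l - x).
  rewrite (bigID (mem s)) /= -big_uniq // [X in _ + X]big1 ?addr0 // => l ls.
  by rewrite Fx // subrr.
rewrite !sumrB sumr_const card_ord big_const_seq count_predT iter_addr addr0.
move/eqP; rewrite subr_eq => /eqP ->.
by rewrite -[x *+ n]mulr_natl -[x *+ size s]mulr_natl; ring.
Qed.

(** The moments of order 6, 4 and 2 obtained by summing M over one, two and
    three indices; b42 stands for E[Z_i^4 Z_j^2], and so on. *)
Let b222 : R := 3 * m211 + (n%:R - 3) * m1111.
Let b42 : R := m31 + m22 + (n%:R - 2) * m211.
Let b6 : R := m4 + (n%:R - 1) * m31.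
Let b22 : R := 2 * b42 + (n%:R - 2) * b222.
Let b4 : R := b6 + (n%:R - 1) * b42.
Let b2 : R := b4 + (n%:R - 1) * b22.

Lemma marginal222 i j k : uniq [:: i; j; k] -> \sum_l M i j k l = b222.
Proof.
move=> u; have := u; rewrite /= !inE negb_or => /and3P[/andP[ij ik] jk _].
rewrite (@sum_off_seq _ [:: i; j; k] m1111) // => [|l].
  rewrite !big_cons big_nil /b222.
  rewrite [M i j k i](swap34 hM) (swap23 hM) (pattern211 hM u).
  rewrite [M i j k j](swap34 hM) (swap12 hM) (swap23 hM).
  rewrite (pattern211 hM); last first.
    by rewrite /= !inE negb_or (eq_sym j i) ij ik jk.
  rewrite [M i j k k](swap23 hM) (swap12 hM) (swap34 hM) (swap23 hM).
  rewrite (pattern211 hM); first by rewrite /=; ring.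
  by rewrite /= !inE negb_or !(eq_sym k) ij ik jk.
rewrite !inE !negb_or => /and3P[li lj lk]; rewrite (pattern1111 hM) //=.
by rewrite !inE !negb_or ij ik jk !(eq_sym _ l) li lj lk.
Qed.

Lemma marginal42 i j : i != j -> \sum_l M i i j l = b42.
Proof.
move=> ij; rewrite (@sum_off_seq _ [:: i; j] m211) /= ?inE ?ij // => [|l].
  rewrite !big_cons big_nil /b42 (swap34 hM) (pattern31 hM)//.
  by rewrite (pattern22 hM)//=; ring.
rewrite !inE !negb_or => /andP[li lj]; rewrite (pattern211 hM) //=.
by rewrite !inE !negb_or ij !(eq_sym _ l) li lj.
Qed.

Lemma marginal6 i : \sum_l M i i i l = b6.
Proof.
rewrite (@sum_off_seq _ [:: i] m31) // => [|l].
  by rewrite big_cons big_nil (pattern4 hM) addr0.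
by rewrite inE eq_sym => il; rewrite (pattern31 hM).
Qed.

Lemma marginal22 i j : i != j -> \sum_k \sum_l M i j k l = b22.
Proof.
move=> ij; rewrite (@sum_off_seq _ [:: i; j] b222) /= ?inE ?ij // => [|k].
  rewrite !big_cons big_nil.
  rewrite -(eq_bigr _ (fun l _ => swap23 hM i i j l)) marginal42 //.
  under eq_bigr do rewrite (swap12 hM) (swap23 hM).
  by rewrite marginal42 1?eq_sym // /b22 /=; ring.
rewrite !inE !negb_or => /andP[ki kj]; apply: marginal222.
by rewrite /= !inE negb_or ij !(eq_sym _ k) ki kj.
Qed.

Lemma marginal4 i : \sum_k \sum_l M i i k l = b4.
Proof.
rewrite (@sum_off_seq _ [:: i] b42) // => [|k].
  by rewrite big_cons big_nil marginal6 addr0.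
by rewrite inE eq_sym => ik; rewrite marginal42.
Qed.

Lemma marginal2 i : \sum_j \sum_k \sum_l M i j k l = b2.
Proof.
rewrite (@sum_off_seq _ [:: i] b22) // => [|j].
  by rewrite big_cons big_nil marginal4 addr0.
by rewrite inE eq_sym => ij; rewrite marginal22.
Qed.

Lemma marginal0 : \sum_i \sum_j \sum_k \sum_l M i j k l = n%:R * b2.
Proof.
under eq_bigr do rewrite marginal2.
by rewrite sumr_const card_ord mulr_natl.
Qed.

(** The total mass 1 gives E[Z_i^2] = 1/n, which determines m4 by the other
    values of M; both sides then are the same function of m31, m22, m211, m1111,
    n and the power sums of a. The factor 1/n cancels because m4 only occurs
    with the power sum of the c_k^4, which is a multiple of n. *)
Lemma quad_moment (a : 'I_n -> R) : (0 < n)%N ->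
  \sum_i \sum_j \sum_k \sum_l M i j k l = 1 -> \sum_k a k = 1 ->
  quad (fun k => n%:R * a k - 1) M =
    K_44 a * n%:R ^+ 4 * m22 + K_22 a * n%:R ^+ 2 * b22
  + K_222 a * n%:R ^+ 3 * b222 + K_2222 a * n%:R ^+ 4 * m1111 + K_const a.
Proof.
move=> n0 M1 a1; rewrite marginal0 in M1.
have nN0 : n%:R != 0 :> R by rewrite pnatr_eq0 -lt0n.
rewrite centered_quad; last first.
  by rewrite sumrB -mulr_sumr a1 sumr_const card_ord mulr1 subrr.
set N := n%:R in M1 nN0 *.
have T2 : power_sum (fun k => N * a k - 1) 2 = N ^+ 2 * power_sum a 2 - N.
  rewrite /power_sum (eq_bigr (fun k => N ^+ 2 * a k ^+ 2 - (2 * N * a k - 1))).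
    rewrite !sumrB -!mulr_sumr a1 sumr_const card_ord -/N; ring.
  by move=> k _; ring.
have T4 : power_sum (fun k => N * a k - 1) 4 = N ^+ 4 * power_sum a 4
    - 4 * N ^+ 3 * power_sum a 3 + 6 * N ^+ 2 * power_sum a 2 - 3 * N.
  rewrite /power_sum (eq_bigr (fun k => N ^+ 4 * a k ^+ 4
    - 4 * N ^+ 3 * a k ^+ 3 + 6 * N ^+ 2 * a k ^+ 2 - (4 * N * a k - 1))).
    rewrite !(sumrB, big_split) /= -!mulr_sumr a1 sumr_const card_ord -/N.
    by ring.
  by move=> k _; ring.
rewrite T2 T4 /K_44 /K_22 /K_222 /K_2222 /K_const.
have em4 : m4 = N^-1 - (N - 1) * b22 - (N - 1) * b42 - (N - 1) * m31.
  have <- : b2 = N^-1 by apply: (mulfI nN0); rewrite M1 mulfV.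
  by rewrite /b2 /b4 /b6 -/N; ring.
rewrite /c4 em4 /c22 /b22 /b42 /b222.
by field.
Qed.

End Exchangeable.

Lemma quad_prod (R : realType) (n : nat) (c x : 'I_n -> R) :
  quad c (fun i j k l => x i * x j * x k * x l) = (\sum_k c k * x k) ^+ 4.
Proof.
transitivity (\sum_i \sum_j \sum_k \sum_l
    (c i * x i) * ((c j * x j) * ((c k * x k) * (c l * x l)))).
  by rewrite /quad; do 4 (apply: eq_bigr => ? _); ring.
under eq_bigr => i _.
  under eq_bigr => j _.
    under eq_bigr do rewrite -!mulr_sumr.
    by rewrite -!mulr_sumr -mulr_suml over.
  by rewrite -!mulr_sumr -mulr_suml over.
by rewrite -mulr_suml !exprS mulr1.
Qed.

(** * Expectations of bounded measurable functions *)

Section BoundedMeasurable.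
Context (d : measure_display) (T : measurableType d) (R : realType).
Variable P : probability T R.

(** The bound holds everywhere and not only almost everywhere: integrability
    then follows from measurability, and the class is closed under the ring
    operations. *)
Definition bounded_measurable (f : T -> R) : Prop :=
  measurable_fun setT f /\ exists C, forall w, `|f w| <= C.

Lemma bounded_measurable_cst x : bounded_measurable (fun=> x).
Proof. by split; [exact: measurable_cst|exists `|x|]. Qed.

Lemma bounded_measurableD f g : bounded_measurable f -> bounded_measurable g ->
  bounded_measurable (fun w => f w + g w).
Proof.
move=> [mf [A fA]] [mg [B gB]]; split; first exact: measurable_funD.
by exists (A + B) => w; rewrite (le_trans (ler_normD _ _)) // lerD.
Qed.

Lemma bounded_measurableM f g : bounded_measurable f -> bounded_measurable g ->
  bounded_measurable (fun w => f w * g w).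
Proof.
move=> [mf [A fA]] [mg [B gB]]; split; first exact: measurable_funM.
by exists (A * B) => w; rewrite normrM ler_pM.
Qed.

Lemma bounded_measurable_sum (I : Type) (s : seq I) (F : I -> T -> R) :
  (forall i, bounded_measurable (F i)) ->
  bounded_measurable (fun w => \sum_(i <- s) F i w).
Proof.
move=> bF; elim: s => [|i s IHs].
  by under eq_fun do rewrite big_nil; exact: bounded_measurable_cst.
by under eq_fun do rewrite big_cons; exact: bounded_measurableD.
Qed.

Lemma bounded_measurable_integrable f : bounded_measurable f ->
  P.-integrable setT (EFin \o f).
Proof.
move=> [mf [C fC]]; apply: measurable_bounded_integrable => //.
  by rewrite ltey_eq fin_num_measure.
by exists C; split=> [|x Cx w _]; rewrite ?num_real //= (le_trans (fC w)) ?ltW.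
Qed.

Lemma Rintegral_sum (I : Type) (s : seq I) (F : I -> T -> R) :
  (forall i, bounded_measurable (F i)) ->
  (\int[P]_w \sum_(i <- s) F i w = \sum_(i <- s) \int[P]_w F i w)%R.
Proof.
move=> bF; elim: s => [|i s IHs].
  rewrite big_nil; under eq_Rintegral do rewrite big_nil.
  by rewrite Rintegral_cst// mul0r.
rewrite big_cons -IHs -RintegralD //; last 2 first.
- exact/bounded_measurable_integrable.
- exact/bounded_measurable_integrable/bounded_measurable_sum.
by apply: eq_Rintegral => w _; rewrite big_cons.
Qed.

Lemma Rintegral_quad (n : nat) (c : 'I_n -> R)
    (F : 'I_n -> 'I_n -> 'I_n -> 'I_n -> T -> R) :
  (forall i j k l, bounded_measurable (F i j k l)) ->
  (\int[P]_w quad c (fun i j k l => F i j k l w) =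
   quad c (fun i j k l => \int[P]_w F i j k l w))%R.
Proof.
move=> bF.
have bcF i j k l :
    bounded_measurable (fun w => c i * c j * c k * c l * F i j k l w).
  by apply: bounded_measurableM => //; exact: bounded_measurable_cst.
rewrite /quad.
do 4 (rewrite Rintegral_sum; [apply: eq_bigr => ? _|
  by move=> *; do ?[apply: bounded_measurable_sum => *]]).
by rewrite RintegralZl//; exact: bounded_measurable_integrable.
Qed.

(** Moves an expectation to an almost everywhere equal bounded function; f
    itself may be unbounded. *)
Lemma expectation_ae f g : measurable_fun setT f -> bounded_measurable g ->
  {ae P, forall w, f w = g w} -> 'E_P[f]%E = (\int[P]_w g w)%:E.
Proof.
move=> mf bg fg; rewrite /Rintegral fineK; last first.
  exact/integrable_fin_num/bounded_measurable_integrable.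
rewrite unlock; apply: ae_eq_integral => //.
- exact/measurable_EFinP.
- by apply/measurable_EFinP; case: bg.
- by apply: filterS fg => w e _; rewrite e.
Qed.

Lemma eq_ae_Rintegral f g : bounded_measurable f -> bounded_measurable g ->
  {ae P, forall w, f w = g w} -> (\int[P]_w f w = \int[P]_w g w)%R.
Proof.
move=> bf bg fg; have [mf _] := bf; apply: EFin_inj.
by rewrite -(expectation_ae mf bg fg) (expectation_ae mf bf) //; exact: aeW.
Qed.

End BoundedMeasurable.

(** * Moments of a random point of the sphere *)

Section UnitSphere.
Context (d : measure_display) (T : measurableType d) (R : realType).
Variables (P : probability T R) (n : nat) (Z : 'I_n -> {RV P >-> R}).
Hypothesis Z1 : {ae P, forall w, \sum_(k < n) Z k w ^+ 2 = 1}.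

Definition trunc_square k w : R := Num.min (Z k w ^+ 2) 1.
Local Notation Q := trunc_square.

Lemma trunc_square_id w k : \sum_(k < n) Z k w ^+ 2 = 1 -> Q k w = Z k w ^+ 2.
Proof.
move=> s1; apply/min_idPl; rewrite -s1 (bigD1 k) //= lerDl.
by apply: sumr_ge0 => i _; exact: sqr_ge0.
Qed.

Lemma bounded_trunc_square k : bounded_measurable (Q k).
Proof.
split.
  by apply: measurable_minr => //; exact: measurable_funX.
by exists 1 => w; rewrite ger0_norm ?le_min ?sqr_ge0 ?ler01 // ge_min lexx orbT.
Qed.

Definition quartic_moment (i j k l : 'I_n) : R :=
  (\int[P]_w (Q i w * Q j w * Q k w * Q l w))%R.
Local Notation M := quartic_moment.

Let bQ := bounded_trunc_square.

Let bQ3 i j k : bounded_measurable (fun w => Q i w * Q j w * Q k w).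
Proof. by do 2 (apply: bounded_measurableM => //). Qed.

Let bQ4 i j k l : bounded_measurable (fun w => Q i w * Q j w * Q k w * Q l w).
Proof. by apply: bounded_measurableM. Qed.

(** The relation \sum_l Z_l^2 = 1 read on moments: summing over the index of a
    factor Z_l^2 deletes that factor. *)
Lemma sum_Rintegral_trunc_square f : bounded_measurable f ->
  \sum_l (\int[P]_w (f w * Q l w))%R = (\int[P]_w f w)%R.
Proof.
move=> bf; rewrite -Rintegral_sum; last by move=> l; exact: bounded_measurableM.
apply: eq_ae_Rintegral => //.
  by apply: bounded_measurable_sum => l; exact: bounded_measurableM.
apply: filterS Z1 => w s1; rewrite -mulr_sumr.
by rewrite (eq_bigr _ (fun k _ => trunc_square_id k s1)) s1 mulr1.
Qed.

Lemma mixed_moment_bounded (e : seq nat) (s : seq 'I_n) (g : T -> R) :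
  bounded_measurable g ->
  (forall w, \sum_(k < n) Z k w ^+ 2 = 1 ->
    \prod_(p <- zip s e) Z p.1 w ^+ p.2 = g w) ->
  mixed_moment Z e s = (\int[P]_w g w)%:E.
Proof.
move=> bg fg; apply: expectation_ae => //.
  by apply: measurable_prod => p _; exact: measurable_funX.
by apply: filterS Z1 => w; exact: fg.
Qed.

Lemma mixed_moment2222 i j k l :
  mixed_moment Z [:: 2; 2; 2; 2]%N [:: i; j; k; l] = (M i j k l)%:E.
Proof.
apply: mixed_moment_bounded => // w s1.
by rewrite !big_cons big_nil !trunc_square_id //=; ring.
Qed.

Lemma mixed_moment422 i j k :
  mixed_moment Z [:: 4; 2; 2]%N [:: i; j; k] = (M i i j k)%:E.
Proof.
apply: mixed_moment_bounded => // w s1.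
by rewrite !big_cons big_nil !trunc_square_id //=; ring.
Qed.

Lemma mixed_moment44 i j :
  mixed_moment Z [:: 4; 4]%N [:: i; j] = (M i i j j)%:E.
Proof.
apply: mixed_moment_bounded => // w s1.
by rewrite !big_cons big_nil !trunc_square_id //=; ring.
Qed.

Lemma mixed_moment62 i j :
  mixed_moment Z [:: 6; 2]%N [:: i; j] = (M i i i j)%:E.
Proof.
apply: mixed_moment_bounded => // w s1.
by rewrite !big_cons big_nil !trunc_square_id //=; ring.
Qed.

Lemma mixed_moment8 i : mixed_moment Z [:: 8]%N [:: i] = (M i i i i)%:E.
Proof.
apply: mixed_moment_bounded => // w s1.
by rewrite !big_cons big_nil !trunc_square_id //=; ring.
Qed.

Lemma mixed_moment222 i j k :
  mixed_moment Z [:: 2; 2; 2]%N [:: i; j; k] = (\sum_l M i j k l)%:E.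
Proof.
rewrite sum_Rintegral_trunc_square //; apply: mixed_moment_bounded => // w s1.
by rewrite !big_cons big_nil !trunc_square_id //=; ring.
Qed.

Lemma mixed_moment22 i j :
  mixed_moment Z [:: 2; 2]%N [:: i; j] = (\sum_k \sum_l M i j k l)%:E.
Proof.
have bQ2 : bounded_measurable (fun w => Q i w * Q j w).
  exact: bounded_measurableM.
under [in RHS]eq_bigr do rewrite sum_Rintegral_trunc_square //.
rewrite sum_Rintegral_trunc_square //; apply: mixed_moment_bounded => // w s1.
by rewrite !big_cons big_nil !trunc_square_id //=; ring.
Qed.

Lemma sum_quartic_moment : \sum_i \sum_j \sum_k \sum_l M i j k l = 1.
Proof.
transitivity (\sum_i \int[P]_w (1 * Q i w))%R; last first.
  rewrite sum_Rintegral_trunc_square; last exact: bounded_measurable_cst.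
  by rewrite Rintegral_cst //= mul1r probability_setT.
apply: eq_bigr => i _; under [RHS]eq_Rintegral do rewrite mul1r.
rewrite -[RHS]sum_Rintegral_trunc_square //; apply: eq_bigr => j _.
rewrite -[RHS]sum_Rintegral_trunc_square; last exact: bounded_measurableM.
by apply: eq_bigr => k _; rewrite sum_Rintegral_trunc_square.
Qed.

(** A pattern with more than n distinct indices does not occur, and beta may be
    infinite there; fine makes the statement uniform in n. *)
Lemma exchangeable_quartic_moment beta : common_even_moments Z beta ->
  exchangeable4 M (fine (beta [:: 8]%N)) (fine (beta [:: 6; 2]%N))
    (fine (beta [:: 4; 4]%N)) (fine (beta [:: 4; 2; 2]%N))
    (fine (beta [:: 2; 2; 2; 2]%N)).
Proof.
move=> H; split=> [i j k l|i j k l|i j k l|i|i j ij|i j ij|i j k u|i j k l u].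
- by apply: eq_Rintegral => w _; ring.
- by apply: eq_Rintegral => w _; ring.
- by apply: eq_Rintegral => w _; ring.
- by rewrite -(H [:: 4]%N [:: i]) // mixed_moment8.
- by rewrite -(H [:: 3; 1]%N [:: i; j]) //= ?inE ?ij // mixed_moment62.
- by rewrite -(H [:: 2; 2]%N [:: i; j]) //= ?inE ?ij // mixed_moment44.
- by rewrite -(H [:: 2; 1; 1]%N [:: i; j; k]) // mixed_moment422.
- by rewrite -(H [:: 1; 1; 1; 1]%N [:: i; j; k; l]) // mixed_moment2222.
Qed.

(** On the sphere 1 = \sum_k Z_k^2, which absorbs the constant -1 into the
    coefficients of the Z_k^2. *)
Lemma expectation_centered_form (a : 'I_n -> R) : \sum_k a k = 1 ->
  'E_P[fun w => ((\sum_(k < n) a k * (n%:R * Z k w ^+ 2 - 1)) ^+ 4)%R]%E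
  = (quad (fun k => n%:R * a k - 1) M)%:E.
Proof.
move=> a1; rewrite -Rintegral_quad //; apply: expectation_ae.
- apply: measurable_funX; apply: measurable_sum => k.
  apply: measurable_funM; first exact: measurable_cst.
  apply: measurable_funB; last exact: measurable_cst.
  by apply: measurable_funM; [exact: measurable_cst|exact: measurable_funX].
- do 4 (apply: bounded_measurable_sum => ?).
  by apply: bounded_measurableM => //; exact: bounded_measurable_cst.
apply: filterS Z1 => w s1; rewrite quad_prod; congr (_ ^+ 4).
transitivity (\sum_(k < n)
    ((n%:R * a k - 1) * Z k w ^+ 2 + (Z k w ^+ 2 - a k))).
  by apply: eq_bigr => k _; ring.
rewrite big_split /= sumrB s1 a1 subrr addr0.
by apply: eq_bigr => k _; rewrite trunc_square_id.
Qed.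

End UnitSphere.

Theorem theorem3p3 (d : measure_display) (T : measurableType d) (R : realType)
    (P : probability T R) (n : nat) (Z : 'I_n -> {RV P >-> R})
    (beta : seq nat -> \bar R) :
  (4 <= n)%N ->
  {ae P, forall w, \sum_(k < n) Z k w ^+ 2 = 1} ->
  common_even_moments Z beta ->
  forall a : 'I_n -> R, \sum_(k < n) a k = 1 ->
  ('E_P[fun w => ((\sum_(k < n) a k * (n%:R * Z k w ^+ 2 - 1)) ^+ 4)%R]
   = (K_44 a * n%:R ^+ 4)%:E * beta [:: 4; 4]%N
     + (K_22 a * n%:R ^+ 2)%:E * beta [:: 2; 2]%N
     + (K_222 a * n%:R ^+ 3)%:E * beta [:: 2; 2; 2]%N
     + (K_2222 a * n%:R ^+ 4)%:E * beta [:: 2; 2; 2; 2]%N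
     + (K_const a)%:E)%E
  /\ K_const a + K_44 a + K_22 a + K_222 a + K_2222 a = 0.
Proof.
move=> n4 Z1 H a a1; split; last first.
  by rewrite /K_const /K_44 /K_22 /K_222 /K_2222; field.
have E := exchangeable_quartic_moment Z1 H.
pose x (k : 'I_4) : 'I_n := widen_ord n4 k.
have [u u3 x01] : [/\ uniq [:: x 0; x 1; x 2; x 3], uniq [:: x 0; x 1; x 2] &
  x 0 != x 1] by [].
have e44 := H [:: 2; 2]%N [:: x 0; x 1] isT isT erefl isT.
have e22 := H [:: 1; 1]%N [:: x 0; x 1] isT isT erefl isT.
have e222 := H [:: 1; 1; 1]%N [:: x 0; x 1; x 2] isT isT erefl isT.
have e2222 := H [:: 1; 1; 1; 1]%N [:: x 0; x 1; x 2; x 3] isT isT erefl isT.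
move: e44 e22 e222 e2222; rewrite /= mixed_moment44 // mixed_moment22 //.
rewrite mixed_moment222 // mixed_moment2222 // => <- <- <- <-.
(* The distinct indices x turn the four common moments into real numbers. *)
rewrite (pattern22 E) // (pattern1111 E) // (marginal22 E) //.
rewrite (marginal222 E) //.
rewrite expectation_centered_form //.
by rewrite (quad_moment E (leq_trans _ n4) (sum_quartic_moment Z1) a1).
Qed.
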